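(* Let $G$ be a directed graph on vertex set $[n]$ (no loops, multiple edges allowed) and write $$\omega\, \mathrm G_G(\mathbf x;q+1)=\sum_{\alpha\vDash n}c^G_\alpha(q)\frac{\Psi_\alpha(\mathbf x)}{z_\alpha}.$$ Then $c^G_\alpha(q)\in\mathbb N[q]$ for all compositions $\alpha$.
   Context: For a coloring $\kappa:[n]\to\mathbb Z_{>0}$, $\mathrm{asc}(\kappa)$ is the number of directed edges $(i,j)$ (with multiplicity) with $\kappa(i)<\kappa(j)$. The unicellular graph LLT polynomial is $\mathrm G_G(\mathbf x;q)=\sum_{\kappa:[n]\to\mathbb Z_{>0}}x_{\kappa(1)}\cdots x_{\kappa(n)}q^{\mathrm{asc}(\kappa)}$ (sum over all colorings); $\mathrm G_G(\mathbf x;q+1)$ is obtained by substituting $q+1$ for $q$. $\omega$ is the linear automorphism of quasisymmetric functions with $\omega(F_{n,S})=F_{n,[n-1]\setminus(n-S)}$, where $F_{n,S}=\sum_{j_1\le\dots\le j_n,\ j_i<j_{i+1}\ (i\in S)}x_{j_1}\cdots x_{j_n}$ and $n-S=\{n-s:s\in S\}$, extended coefficientwise in $q$. For compositions: $S_\alpha=\{\alpha_1,\dots,\alpha_1+\dots+\alpha_{\ell-1}\}$, blocks $B_i(\alpha)$ consecutive intervals of sizes $\alpha_i$, $\alpha\le\beta$ iff $S_\beta\subseteq S_\alpha$; $M_\alpha=\sum_{i_1<\dots<i_\ell}x_{i_1}^{\alpha_1}\cdots x_{i_\ell}^{\alpha_\ell}$; $z_\alpha=\prod_i i^{m_i}m_i!$;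 $\pi(\gamma)=\prod_i(\gamma_1+\dots+\gamma_i)$; $\pi(\alpha,\beta)=\prod_i\pi(\alpha^{(i)})$ with $\alpha^{(i)}$ the parts of $\alpha$ whose blocks lie in $B_i(\beta)$; $\Psi_\alpha=z_\alpha\sum_{\beta\ge\alpha}\pi(\alpha,\beta)^{-1}M_\beta$. *)

(* Defs.v *)
From HB Require Import structures.
From mathcomp Require Import all_boot all_order all_algebra.
Set Implicit Arguments. Unset Strict Implicit. Unset Printing Implicit Defensive.
Import Order.TTheory GRing.Theory Num.Theory.
Local Open Scope ring_scope.

Fixpoint comps_rec (fuel n : nat) : seq (seq nat) :=
  match fuel with
  | 0 => if n == 0%N then [:: [::]] else [::]
  | fuel'.+1 =>
      if n == 0%N then [:: [::]]
      else flatten [seq [seq k.+1 :: a | a <- comps_rec fuel' (n - k.+1)]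
                   | k <- iota 0 n]
  end.
Definition compositions (n : nat) : seq (seq nat) := comps_rec n n.

Definition desc (a : seq nat) : seq nat :=
  [seq sumn (take k a) | k <- iota 1 (size a).-1].

Definition comp_le (a b : seq nat) : bool := all (fun s => s \in desc a) (desc b).

Definition omega_set (n : nat) (S : seq nat) : seq nat :=
  [seq i <- iota 1 n.-1 | (n - i)%N \notin S].

(* ---------- Monomial coefficients in N variables x_0..x_{N-1} ----------
   A formal power series in x_0, x_1, ... is determined by the coefficients
   of all monomials x^e with e : 'I_N -> nat, for all N. *)

Definition Mcoef (b : seq nat) (N : nat) (e : 'I_N -> nat) : nat :=
  nat_of_bool ([seq k <- [seq e i | i <- enum 'I_N] | k != 0%N] == b).

Definition has_content n N (f : 'I_n -> 'I_N) (e : 'I_N -> nat) : bool :=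
  [forall c : 'I_N, #|[set i | f i == c]| == e c].

Definition Fcoef (n : nat) (S : seq nat) (N : nat) (e : 'I_N -> nat) : nat :=
  #|[set j : {ffun 'I_n -> 'I_N} |
      [forall k : 'I_n, forall l : 'I_n,
         (val l == (val k).+1) ==>
         ((val (j k) <= val (j l))%N && ((val l \in S) ==> (val (j k) < val (j l))%N))]
      && has_content j e]|.

(* A directed multigraph on [n]: m i j = number of directed edges (i,j). *)
Definition asc n N (m : 'I_n -> 'I_n -> nat) (k : 'I_n -> 'I_N) : nat :=
  (\sum_(i : 'I_n) \sum_(j : 'I_n) (if (val (k i) < val (k j))%N then m i j else 0%N))%N.

Definition Gcoef_shift n (m : 'I_n -> 'I_n -> nat) (N : nat) (e : 'I_N -> nat)
  : {poly rat} :=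
  \sum_(k : {ffun 'I_n -> 'I_N} | has_content k e) ('X + 1) ^+ asc m k.

Definition pi_seq (g : seq nat) : nat := (\prod_(k < size g) sumn (take k.+1 g))%N.

(* alpha^(i): parts of alpha whose blocks lie in B_i(beta) *)
Definition sub_parts (a b : seq nat) (i : nat) : seq nat :=
  [seq nth 0%N a j | j <- iota 0 (size a) &
     (sumn (take i b) <= sumn (take j a))%N && (sumn (take j.+1 a) <= sumn (take i.+1 b))%N].

Definition pi2 (a b : seq nat) : nat := (\prod_(i < size b) pi_seq (sub_parts a b i))%N.

Definition zee (a : seq nat) : nat :=
  (\prod_(1 <= i < (sumn a).+1) (i ^ count_mem i a * (count_mem i a)`!))%N.

Definition Psi_coef (n : nat) (a : seq nat) (N : nat) (e : 'I_N -> nat) : rat :=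
  (zee a)%:R * \sum_(b <- compositions n | comp_le a b)
                  ((pi2 a b)%:R)^-1 * (Mcoef b e)%:R.

(* Main.v *)
Require Import Defs.
From HB Require Import structures.
From mathcomp Require Import all_boot all_order all_algebra zify.
Import Order.TTheory GRing.Theory Num.Theory.

(** Expanding [(q+1)^asc] over sets of edges writes [G_G(x;q+1)] as a sum, with
    coefficients in [N[q]], of generating functions of colorings that increase
    strictly along the edges of a subgraph [E]. Such a generating function
    vanishes if [E] has a cycle, and otherwise [omega] replaces strict by weak
    monotonicity (and reverses the colors). It remains to see that the weak
    colorings are Psi-positive: the coefficient of [Psi_alpha / z_alpha] counts
    the weak colorings of type [alpha] each of whose color classes has a
    greatest element.

    Both steps come from one principle. Refining the color classes of weak
    colorings reduces the claim to an identity for one class [A], where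
    chains of lower sets of [A] are summed with weights: signs for
    strict colorings, [1 / pi] for pointed ones. The sum is [1] by induction on
    [|A|], removing the first block: for signs because the nonempty sets of
    minimal elements have alternating sum [1], for pointed blocks because each
    of the [|A|] generators contributes [1 / |A|]. *)

Local Notation pos := (all (fun k => 0 < k)%N).

(** * Compositions and refinements *)

Lemma comps_recS f n : comps_rec f.+1 n.+1 =
  flatten [seq [seq k.+1 :: a | a <- comps_rec f (n - k)] | k <- iota 0 n.+1].
Proof. by []. Qed.

Lemma comps_rec_fuel f g n : (n <= f)%N -> (n <= g)%N ->
  comps_rec f n = comps_rec g n.
Proof.
elim: f g n => [|f IH] [|g] [|n] // nf ng; rewrite !comps_recS.
by congr (flatten _); apply: eq_map => k; rewrite (IH g) //; lia.
Qed.

Lemma compositionsS n : compositions n.+1 =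
  flatten [seq [seq k.+1 :: a | a <- compositions (n - k)] | k <- iota 0 n.+1].
Proof.
rewrite {1}/compositions comps_recS; congr (flatten _).
by apply: eq_map => k; congr map; apply: comps_rec_fuel; lia.
Qed.

Lemma big_compositionsS {R : nmodType} n (F : seq nat -> R) :
  (\sum_(a <- compositions n.+1) F a =
   \sum_(k < n.+1) \sum_(a <- compositions (n - k)) F (k.+1 :: a))%R.
Proof.
rewrite compositionsS big_flatten big_map -[X in iota 0 X]subn0.
rewrite -/(index_iota 0 n.+1) big_mkord.
by apply: eq_bigr => k _; rewrite big_map.
Qed.

Lemma mem_compositions n a : (a \in compositions n) = pos a && (sumn a == n).
Proof.
elim/ltn_ind: n a => -[|n] IH a.
  by case: a => [|[|k] a] //=; rewrite inE; case: (pos a).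
rewrite compositionsS; apply/flatten_mapP/idP => [[k]|].
  rewrite mem_iota => hk /mapP[x hx ->] /=.
  by move: hx; rewrite IH; last lia; case: (pos x) => //=; lia.
case: a => [|[|k] a] //= /andP[pa /eqP sa].
exists k; first by rewrite -[_ :: _]/(iota 0 n.+1) mem_iota; lia.
by apply/mapP; exists a; rewrite // IH ?pa //=; lia.
Qed.

Lemma uniq_compositions n : uniq (compositions n).
Proof.
elim/ltn_ind: n => -[|n] IH //.
rewrite compositionsS; apply: (@allpairs_uniq_dep _ _ _ (fun k a => k.+1 :: a)
  (iota 0 n.+1) (fun k => compositions (n - k))).
- exact: iota_uniq.
- by move=> k; rewrite mem_iota => hk; apply: IH; lia.
- by move=> [k a] [l b] _ _ /= [-> ->].
Qed.

(** Unlike [desc], this includes both endpoints [0] and [sumn a], which spares boundary cases under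
    concatenation and reversal. *)
Definition psums (a : seq nat) : seq nat :=
  [seq sumn (take j a) | j <- iota 0 (size a).+1].

Lemma psumsP s a :
  reflect (exists2 j, (j <= size a)%N & s = sumn (take j a)) (s \in psums a).
Proof.
apply: (iffP mapP) => -[j hj ->]; exists j => //.
  by move: hj; rewrite mem_iota; lia.
by rewrite mem_iota; lia.
Qed.

Lemma mem_psums_cat s a b : (s \in psums (a ++ b)) =
  (s \in psums a) || ((sumn a <= s)%N && (s - sumn a \in psums b)%N).
Proof.
apply/psumsP/orP => [[j hj ->]|[|]].
- rewrite take_cat; case: ltnP => h.
    by left; apply/psumsP; exists j => //; exact: ltnW.
  right; rewrite sumn_cat leq_addr addKn; apply/psumsP.
  by exists (j - size a)%N => //; move: hj; rewrite size_cat; lia.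
- move=> /psumsP[j hj ->]; exists j; first by rewrite size_cat; lia.
  by rewrite takel_cat.
- case/andP => h /psumsP[j hj e]; exists (size a + j)%N.
    by rewrite size_cat leq_add2l.
  by rewrite take_cat ltnNge leq_addr /= addKn sumn_cat -e subnKC.
Qed.

Lemma psums0 a : 0%N \in psums a.
Proof. by apply/psumsP; exists 0%N; rewrite ?take0. Qed.

Lemma psums_sumn a : sumn a \in psums a.
Proof. by apply/psumsP; exists (size a); rewrite ?take_size. Qed.

Lemma psums1 k : psums [:: k] = [:: 0; k]%N.
Proof. by rewrite /psums /= addn0. Qed.

Lemma psums_le s a : s \in psums a -> (s <= sumn a)%N.
Proof.
by case/psumsP => j _ ->; rewrite -[X in (_ <= sumn X)%N](cat_take_drop j) sumn_cat leq_addr.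
Qed.

Lemma mem_psums_rev s a : (s <= sumn a)%N ->
  (s \in psums (rev a)) = (sumn a - s \in psums a)%N.
Proof.
suff H b t : (t <= sumn b)%N -> (t \in psums b) -> (sumn b - t \in psums (rev b))%N.
  move=> h; apply/idP/idP => hs.
    by have := H _ _ _ hs; rewrite sumn_rev revK; apply.
  by have := H a _ (leq_subr s _) hs; rewrite subKn.
move=> _ /psumsP[j hj ->]; apply/psumsP; exists (size b - j)%N.
  by rewrite size_rev leq_subr.
rewrite take_rev sumn_rev subKn // -[X in (sumn X - _)%N](cat_take_drop j).
by rewrite sumn_cat addKn.
Qed.

Lemma pos_size a : pos a -> (size a <= sumn a)%N.
Proof. by elim: a => //= k a IH /andP[? /IH]; lia. Qed.

Lemma sumn_take_lt a i j : pos a -> (i < j <= size a)%N ->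
  (sumn (take i a) < sumn (take j a))%N.
Proof.
move=> pa /andP[ij ja].
rewrite -(subnKC (ltnW ij)) takeD sumn_cat -[X in (X < _)%N]addn0 ltn_add2l.
have := @pos_size (take (j - i) (drop i a)).
rewrite size_takel ?size_drop; last by lia.
suff -> : pos (take (j - i) (drop i a)) by move=> /(_ isT); lia.
by apply/allP => x /mem_take /mem_drop; apply: (allP pa).
Qed.

Lemma mem_desc s a : pos a ->
  (s \in desc a) = (s \in psums a) && (0 < s < sumn a)%N.
Proof.
move=> pa; apply/mapP/andP => [[j]|[/psumsP[j hj ->] /andP[h0 h1]]].
  rewrite mem_iota => hj ->; have ja : (0 < j < size a)%N by lia.
  split; first by apply/psumsP; exists j => //; lia.
  rewrite -[X in (X < _)%N]/(sumn (take 0 [::])) -{1}(take0 a) /=.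
  have := @sumn_take_lt a 0 j pa; rewrite take0 /= => ->; last by lia.
  by rewrite /= -[X in (_ < sumn X)%N]take_size sumn_take_lt //; lia.
exists j => //; rewrite mem_iota.
have : j != 0%N by apply: contraTneq h0 => ->; rewrite take0.
have : j != size a by apply: contraTneq h1 => ->; rewrite take_size ltnn.
by lia.
Qed.

Lemma comp_leP a b : pos a -> pos b -> sumn a = sumn b ->
  reflect {subset psums b <= psums a} (comp_le a b).
Proof.
move=> pa pb sab; apply: (iffP allP) => h s.
  move=> sb; have := psums_le _ _ sb; rewrite leq_eqVlt => /orP[/eqP->|s1].
    by rewrite -sab psums_sumn.
  have [->|s0] := posnP s; first exact: psums0.
  by have := h s; rewrite !mem_desc // sb s0 s1 => /(_ isT) /andP[].
by rewrite !mem_desc // sab => /andP[/h -> ->].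
Qed.

(** * Refinements, built part by part *)

Fixpoint refinements (b : seq nat) : seq (seq nat) :=
  if b is k :: b' then [seq g ++ a | g <- compositions k, a <- refinements b']
  else [:: [::]].

(** If [a] refines [k :: b], then [k] is a partial sum of [a]; cutting [a] there gives a composition
    of [k] and a refinement of [b]. *)
Lemma mem_refinements a b : pos b ->
  (a \in refinements b) = [&& pos a, sumn a == sumn b & comp_le a b].
Proof.
elim: b a => [|k b IH] a /=.
  by case: a => [|[|k] a] //=; rewrite inE; case: (pos a).
case/andP => k0 pb; apply/allpairsP/and3P => [[[g c] /= [hg hc ->]]|[pa /eqP sa hab]].
  move: hg hc; rewrite mem_compositions IH // => /andP[pg /eqP sg] /and3P[pc /eqP sc hcb].
  have pgc : pos (g ++ c) by rewrite all_cat pg.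
  have sgc : sumn (g ++ c) = sumn (k :: b) by rewrite sumn_cat sg sc.
  split => //; first by rewrite sgc.
  apply/comp_leP => //=; first by rewrite k0.
  have /comp_leP := hcb => /(_ pc pb sc) sub s.
  rewrite -cat1s !mem_psums_cat /= addn0 => /orP[].
    rewrite psums1 [_ \in [:: _; _]]inE mem_seq1 => /orP[] /eqP->; rewrite ?psums0 //.
    by rewrite -{1}sg psums_sumn.
  by case/andP => h /sub; rewrite sg h => ->; rewrite orbT.
have /comp_leP := hab; rewrite /= k0 => /(_ pa pb sa) sub.
have kP : k \in psums (k :: b) by apply/psumsP; exists 1%N; rewrite //= take0 /= addn0.
have /psumsP[j ja ek] := sub _ kP.
exists (take j a, drop j a); rewrite /= cat_take_drop mem_compositions -ek eqxx.
have /andP[pt pd] : pos (take j a) && pos (drop j a) by rewrite -all_cat cat_take_drop.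
have sd : sumn (drop j a) = sumn b.
  by move: sa; rewrite -{1}(cat_take_drop j a) sumn_cat -ek => /addnI.
rewrite pt IH // pd sd eqxx; split => //=.
apply/comp_leP => // s sb; have /sub : (k + s)%N \in psums (k :: b).
  by rewrite -cat1s mem_psums_cat /= addn0 leq_addr addKn sb orbT.
rewrite -{1}(cat_take_drop j a) mem_psums_cat -ek leq_addr addKn => /orP[|//].
(* A partial sum [k + s] lying in the first piece is at most [k], which forces [s = 0]. *)
move=> /psums_le; rewrite -ek => h; have -> : s = 0%N by lia.
exact: psums0.
Qed.

Lemma cat_sumn_inj a1 a2 b1 b2 : pos a1 -> pos a2 -> sumn a1 = sumn a2 ->
  a1 ++ b1 = a2 ++ b2 -> a1 = a2 /\ b1 = b2.
Proof.
elim: a1 a2 => [|k a1 IH] [|l a2] //=; try by move=> *; lia.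
move=> /andP[_ p1] /andP[_ p2] h [ekl e]; subst l.
suff [-> ->] : a1 = a2 /\ b1 = b2 by [].
by apply: IH => //; lia.
Qed.

Lemma uniq_refinements b : pos b -> uniq (refinements b).
Proof.
elim: b => //= k b IH /andP[k0 /IH u].
apply: allpairs_uniq => //; first exact: uniq_compositions.
move=> [g c] [g' c'] /allpairsP[[x y] /= [hx hy [-> ->]]].
move=> /allpairsP[[x' y'] /= [hx' hy' [-> ->]]].
move: hx hx'; rewrite !mem_compositions => /andP[p1 /eqP s1] /andP[p2 /eqP s2].
by case/(cat_sumn_inj _ _ _ _ p1 p2 (etrans s1 (esym s2))) => -> ->.
Qed.

(** Source of the triangularity in [expansion_unique], where the induction runs from long
    compositions to short ones. *)
Lemma refinements_size a b : pos b -> a \in refinements b ->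
  (size b < size a)%N || (a == b).
Proof.
elim: b a => [|k b IH] a /=; first by rewrite inE => _ /eqP->.
move=> /andP[k0 pb] /allpairsP[[g c] /= [hg /(IH _ pb) hc ->]].
move: hg; rewrite mem_compositions => /andP[pg /eqP sg].
case: g pg sg => [|x [|y g]] /=; try lia.
  rewrite addn0 => _ ->; rewrite ltnS eqseq_cons eqxx /=.
  by case/orP: hc => ->; rewrite ?orbT.
by move=> _ _; apply/orP; left; case/orP: hc => [|/eqP->]; rewrite /= size_cat; lia.
Qed.

Lemma compositions_rev n a : (rev a \in compositions n) = (a \in compositions n).
Proof. by rewrite !mem_compositions all_rev sumn_rev. Qed.

Lemma comp_le_rev a b : pos a -> pos b -> sumn a = sumn b ->
  comp_le (rev a) (rev b) = comp_le a b.
Proof.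
suff H c d : pos c -> pos d -> sumn c = sumn d -> comp_le c d -> comp_le (rev c) (rev d).
  move=> pa pb sab; apply/idP/idP => h; last exact: H.
  by have := H _ _ _ _ _ h; rewrite !revK !all_rev !sumn_rev; apply.
move=> pc pd scd /comp_leP => /(_ pc pd scd) sub.
apply/comp_leP; rewrite ?all_rev ?sumn_rev // => s hs.
have hsd := psums_le _ _ hs; rewrite sumn_rev in hsd.
by move: hs; rewrite !mem_psums_rev ?scd // => /sub.
Qed.

Lemma big_comp_le {R : nmodType} n b (F : seq nat -> R) : b \in compositions n ->
  (\sum_(a <- compositions n | comp_le a b) F a = \sum_(a <- refinements b) F a)%R.
Proof.
rewrite mem_compositions => /andP[pb /eqP sb].
rewrite -big_filter; apply: perm_big; apply: uniq_perm.
- by rewrite filter_uniq ?uniq_compositions.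
- exact: uniq_refinements.
move=> a; rewrite mem_filter mem_refinements // mem_compositions sb.
by rewrite andbC andbA.
Qed.

Lemma big_refinements_rev {R : nmodType} b (F : seq nat -> R) : pos b ->
  (\sum_(a <- refinements b) F a = \sum_(a <- refinements (rev b)) F (rev a))%R.
Proof.
move=> pb; rewrite -(big_map rev xpredT F); apply: perm_big; apply: uniq_perm.
- exact: uniq_refinements.
- rewrite map_inj_uniq ?uniq_refinements ?all_rev //; exact: (can_inj revK).
move=> a; rewrite -[a in RHS]revK mem_map; last exact: (can_inj revK).
rewrite !mem_refinements ?all_rev // !sumn_rev.
case pa: (pos a) => //=; case: eqP => //= sab.
by rewrite comp_le_rev.
Qed.

Local Open Scope ring_scope.

(** * Chains of lower sets *)

(** Blocks of sizes [a] are removed from [Q] one after the other until nothing is left; [mu Q A] is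
    the multiplicity with which [A] may be the next block when [Q] remains. Strict, weak and pointed
    colorings differ only in [mu]. *)
Fixpoint block_count {T : finType} (mu : {set T} -> {set T} -> nat) (a : seq nat)
    (Q : {set T}) : nat :=
  if a is k :: a' then
    (\sum_(A : {set T} | #|A| == k) mu Q A * block_count mu a' (Q :\: A))%N
  else Q == set0.

Definition down {T : finType} (E : rel T) (Q A : {set T}) : bool :=
  (A \subset Q) && [forall x in Q, forall y in A, E x y ==> (x \in A)].

Lemma downP {T : finType} (E : rel T) (Q A : {set T}) :
  reflect (A \subset Q /\ forall x y, x \in Q -> y \in A -> E x y -> x \in A)
          (down E Q A).
Proof.
apply: (iffP andP) => -[sAQ h]; split => //.
  by move=> x y xQ yA Exy; move/forall_inP: h => /(_ _ xQ) /forall_inP /(_ _ yA) /implyP; apply.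
by apply/forall_inP => x xQ; apply/forall_inP => y yA; apply/implyP; apply: h.
Qed.

Lemma down_trans {T : finType} (E : rel T) (Q A B : {set T}) :
  down E Q A -> down E A B -> down E Q B.
Proof.
move=> /downP[sA hA] /downP[sB hB]; apply/downP; split; first exact: subset_trans sA.
move=> x y xQ yB Exy; apply: (hB x y) => //; apply: (hA x y) => //.
exact: (subsetP sB).
Qed.

Lemma down_sub {T : finType} (E : rel T) (Q A B : {set T}) :
  A \subset Q -> B \subset A -> down E Q B -> down E A B.
Proof.
move=> sA sB /downP[_ hB]; apply/downP; split=> // x y xA.
by apply: hB; apply: (subsetP sA).
Qed.

Lemma down_setU {T : finType} (E : rel T) (Q B C : {set T}) : down E Q B ->
  down E (Q :\: B) C = [&& down E Q (B :|: C) & (B :|: C) :\: B == C].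
Proof.
move=> /downP[sB hB]; apply/downP/andP => [[sC hC]|[/downP[sU hU] /eqP eC]].
  split; last first.
    rewrite setDUl setDv set0U; apply/eqP/setDidPl.
    by rewrite disjoints_subset (subset_trans sC) // setDE subsetIr.
  apply/downP; split.
    by rewrite subUset sB (subset_trans sC) ?subsetDl.
  move=> x y xQ /setUP[yB|yC] Exy; apply/setUP; first by left; apply: hB Exy.
  by have [xB|xB] := boolP (x \in B); [left|right; apply: hC Exy; rewrite // inE xB].
split; first by rewrite -eC setSD.
move=> x y /setDP[xQ xB] yC Exy; have : x \in B :|: C.
  by apply: hU Exy; rewrite // inE yC orbT.
by rewrite inE (negPf xB).
Qed.

(** This allows a chain to be cut at a lower set [A] of [Q]: blocks are lower sets, and the
    multiplicity of a block inside [A] can be computed in [A]. *)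
Definition tail_closed {T : finType} (E : rel T) (mu : {set T} -> {set T} -> nat) :=
  (forall Q A, mu Q A != 0%N -> down E Q A) /\
  (forall Q A B : {set T}, down E Q A -> B \subset A -> mu Q B = mu A B).

Lemma block_count_size {T : finType} (E : rel T) mu a (Q : {set T}) :
  tail_closed E mu -> #|Q| != sumn a -> block_count mu a Q = 0%N.
Proof.
case=> hmu _; elim: a Q => [|k a IH] Q /=.
  by rewrite cards_eq0 => /negPf->.
move=> hQ; rewrite big1 // => A /eqP kA.
have [->|/hmu/downP[sA _]] := eqVneq (mu Q A) 0%N; first by rewrite mul0n.
rewrite IH ?muln0 //; apply: contraNneq hQ => <-.
by rewrite cardsDS // kA subnKC // -kA subset_leq_card.
Qed.

(** Here [A] is the union of the blocks with sizes [g]; the chain splits into a chain of [A] and a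
    chain of the rest of [Q]. *)
Lemma block_count_cat {T : finType} (E : rel T) mu g a (Q : {set T}) :
  tail_closed E mu ->
  block_count mu (g ++ a) Q =
  (\sum_(A : {set T} | down E Q A) block_count mu g A * block_count mu a (Q :\: A))%N.
Proof.
case=> hmu tmu; elim: g Q => [|k g IH] Q /=.
  rewrite (bigD1 set0) /=; last by apply/downP; rewrite sub0set; split=> // x y _; rewrite inE.
  rewrite eqxx mul1n setD0 big1 ?addn0 // => A /andP[_ /negPf->].
  by rewrite mul0n.
under [RHS]eq_bigr do rewrite big_distrl /=.
rewrite exchange_big /=; apply: eq_bigr => B _; rewrite IH.
have [B0|/hmu dB] := eqVneq (mu Q B) 0%N.
  rewrite B0 mul0n big1 // => A dA.
  have [sBA|sBA] := boolP (B \subset A); first by rewrite -(tmu Q) // B0.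
  have [->|/hmu/downP[]] := eqVneq (mu A B) 0%N; first by rewrite !mul0n.
  by rewrite (negPf sBA).
rewrite [RHS](bigID (fun A : {set T} => B \subset A)) /= [X in (_ + X)%N]big1 ?addn0; last first.
  move=> A /andP[dA sBA]; have [->|/hmu/downP[]] := eqVneq (mu A B) 0%N.
    by rewrite !mul0n.
  by rewrite (negPf sBA).
(* With [B] the first block, [A] is [B :|: C], where [C] is the union of the other blocks of [g]. *)
rewrite [RHS](reindex_onto (fun C => B :|: C) (fun A => A :\: B)) /=; last first.
  move=> A /andP[_ sBA]; apply/setP => x; rewrite !inE.
  by case xB: (x \in B); rewrite //= (subsetP sBA).
rewrite big_distrr /=; apply: eq_big => [C|C].
  by rewrite (down_setU _ _ _ _ dB) subsetUl andbT.
rewrite (down_setU _ _ _ _ dB) => /andP[dU /eqP eC].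
by rewrite eC -(tmu Q) ?subsetUl // setDDl mulnA.
Qed.

Definition weak_block {T : finType} (E : rel T) (Q A : {set T}) : nat := down E Q A.

(** Chains are grouped by the union [A] of the blocks refining the first part of [b].
    Multiplicativity of [W] isolates the weighted sum over chains of [A]; this is [1] by hypothesis,
    so all that remains of [A] is that it is a lower set of size [k]. *)
Lemma sum_refinements_block_count {T : finType} (R : comNzRingType) (E : rel T) mu
    (w : seq nat -> R) (W : seq nat -> seq nat -> R) b (Q : {set T}) :
  tail_closed E mu ->
  (forall A : {set T}, \sum_(g <- compositions #|A|) w g * (block_count mu g A)%:R = 1) ->
  W [::] [::] = 1 ->
  (forall k b g a, (0 < k)%N -> pos b -> g \in compositions k -> a \in refinements b ->
     W (k :: b) (g ++ a) = w g * W b a) ->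
  pos b ->
  \sum_(a <- refinements b) W b a * (block_count mu a Q)%:R
  = (block_count (weak_block E) b Q)%:R.
Proof.
move=> tmu hw W0 WM; elim: b Q => [|k b IH] Q.
  by move=> _; rewrite /= big_seq1 W0 mul1r.
move=> /andP[k0 pb]; rewrite [refinements _]/= big_allpairs_dep /=.
transitivity (\sum_(A : {set T} | down E Q A)
   (\sum_(g <- compositions k) w g * (block_count mu g A)%:R) *
   (\sum_(a <- refinements b) W b a * (block_count mu a (Q :\: A))%:R)).
  under [RHS]eq_bigr do rewrite mulr_suml.
  rewrite [RHS]exchange_big /=; apply: eq_big_seq => g hg.
  under [RHS]eq_bigr do rewrite mulr_sumr.
  rewrite [RHS]exchange_big /=; apply: eq_big_seq => a ha.
  rewrite WM // (block_count_cat E) // natr_sum mulr_sumr; apply: eq_bigr => A _.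
  by rewrite natrM mulrACA.
rewrite natr_sum (bigID (fun A : {set T} => #|A| == k)) /= [X in _ + X]big1 ?addr0; last first.
  move=> A /andP[_ Ak]; rewrite big1_seq ?mul0r // => g /andP[_].
  rewrite mem_compositions => /andP[_ /eqP sg].
  by rewrite (block_count_size E) ?mulr0 // sg.
rewrite [RHS](bigID (fun A => down E Q A)) /= [X in _ = _ + X]big1 ?addr0; last first.
  by move=> A /andP[_ /negPf dA]; rewrite /weak_block dA mul0n.
apply: eq_big => [A|A]; first exact: andbC.
by case/andP=> dA /eqP <-; rewrite hw mul1r IH // /weak_block dA mul1n.
Qed.

(** Splits off the first block [B]; the two evaluations by induction on [#|A|] start from this
    recursion. *)
Lemma sum_compositions_block_count {T : finType} (R : comNzRingType) (E : rel T) mu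
    (v : seq nat -> R) (A : {set T}) : tail_closed E mu -> A != set0 ->
  \sum_(g <- compositions #|A|) v g * (block_count mu g A)%:R =
  \sum_(B : {set T} | B != set0) (mu A B)%:R *
     \sum_(g <- compositions #|A :\: B|) v (#|B| :: g) * (block_count mu g (A :\: B))%:R.
Proof.
case=> hmu _; rewrite -card_gt0; case eA: #|A| => [//|n] _.
rewrite big_compositionsS.
rewrite [RHS](bigID (fun B : {set T} => B \subset A)) /= [X in _ = _ + X]big1 ?addr0; last first.
  move=> B /andP[_ sBA]; have [->|/hmu/downP[]] := eqVneq (mu A B) 0%N.
    by rewrite mul0r.
  by rewrite (negPf sBA).
(* The first part is [k.+1], so [B] is filed under [#|B|.-1], which is below [n.+1] for the
   remaining [B], all contained in [A]. *)
rewrite (partition_big (fun B : {set T} => inord #|B|.-1 : 'I_n.+1) xpredT) //=.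
apply: eq_bigr => k _.
under eq_bigr do rewrite natr_sum mulr_sumr.
rewrite exchange_big /= (bigID (fun B : {set T} => B \subset A)) /= [X in _ + X]big1 ?addr0; last first.
  move=> B /andP[_ sBA]; rewrite big1 // => g _.
  have [->|/hmu/downP[]] := eqVneq (mu A B) 0%N; first by rewrite mul0n mulr0.
  by rewrite (negPf sBA).
have kE (B : {set T}) : B \subset A ->
    (#|B| == k.+1) = (B != set0) && (inord #|B|.-1 == k).
  move=> sBA; rewrite -card_gt0.
  have := subset_leq_card sBA; rewrite eA; case eB: #|B| => [|c] //= hc.
  by rewrite -val_eqE /= inordK.
apply: eq_big => [B|B].
  by rewrite andbC [RHS]andbAC; case sBA: (B \subset A); rewrite ?andbF //= kE ?andbT.
case/andP=> /eqP cB sBA; rewrite cardsDS // eA cB subSS mulr_sumr; apply: eq_bigr => g _.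
by rewrite natrM mulrCA.
Qed.

(** * Signed and weighted chain counts of a single class *)

Definition source {T : finType} (E : rel T) (Q : {set T}) (x : T) : bool :=
  (x \in Q) && [forall y in Q, ~~ E y x].

(** The lowest class of a strict coloring consists of sources, but need not contain all of them. *)
Definition strict_block {T : finType} (E : rel T) (Q A : {set T}) : nat :=
  A \subset [set x | source E Q x].

(** On a finite type this is equivalent to the absence of directed cycles, loops included. *)
Definition acyclic {T : finType} (E : rel T) : bool :=
  [forall Q : {set T}, (Q != set0) ==> [exists x, source E Q x]].

Lemma tail_closed_strict {T : finType} (E : rel T) : tail_closed E (strict_block E).
Proof.
have H (Q A : {set T}) : strict_block E Q A != 0%N -> down E Q A.
  rewrite /strict_block eqb0 negbK => /subsetP sA; apply/downP; split.
    by apply/subsetP => x /sA; rewrite inE => /andP[].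
  move=> x y xQ /sA; rewrite inE => /andP[_ /forall_inP /(_ _ xQ)].
  by move/negPf->.
split=> // Q A B dA sB; have /downP[sA hA] := dA; congr nat_of_bool.
apply/subsetP/subsetP => h x xB; have := h _ xB; rewrite !inE => /andP[_ /forall_inP hx].
  by rewrite /source (subsetP sB) //=; apply/forall_inP => y /(subsetP sA); apply: hx.
have xA := subsetP sB _ xB; rewrite /source (subsetP sA) //=.
apply/forall_inP => y yQ; apply/negP => Eyx.
by have := hx y (hA _ _ yQ xA Eyx); rewrite Eyx.
Qed.

(** Expansion of a product with factor [-1 + 1] at each element of [M] and [0 + 1] elsewhere. *)
Lemma sum_sign_subsets {T : finType} (R : comNzRingType) (M : {set T}) : M != set0 ->
  \sum_(B : {set T} | B \subset M) (-1) ^+ #|B| = 0 :> R.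
Proof.
case/set0Pn => x xM.
have := @bigA_distr R 0 1 *%R +%R T (fun i => if i \in M then -1 else 0) (fun=> 1).
rewrite (bigD1 x) //= xM addNr mul0r => e.
rewrite [RHS]e big_mkcond /=; apply: eq_big => // B _; rewrite -big_mkcond /=.
case: ifPn => [/subsetP sB|/subsetPn[y yB yM]].
  by rewrite (eq_bigr (fun=> -1)) ?prodr_const // => i /sB ->.
by rewrite (bigD1 y) //= (negPf yM) mul0r.
Qed.

(** Same parity as [sumn a - size a], without truncated subtraction. *)
Definition sign_weight {R : comNzRingType} (a : seq nat) : R := (-1) ^+ (sumn a + size a).

(** By induction, what follows a first block [B] sums to [1]. There remains the sum of
    [(-1) ^+ #|B|.+1] over nonempty sets of sources, which is [1] because the signed sum over all
    subsets vanishes; acyclicity provides a source. *)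
Lemma sum_strict_block_count {T : finType} (R : comNzRingType) (E : rel T) (A : {set T}) :
  acyclic E ->
  \sum_(g <- compositions #|A|) sign_weight g * (block_count (strict_block E) g A)%:R
  = 1 :> R.
Proof.
move=> /forallP acE; move eN: #|A| => N; elim/ltn_ind: N A eN => N IH A eN.
have [A0|A0] := eqVneq A set0.
  by rewrite -eN A0 cards0 big_seq1 /= eqxx mulr1.
rewrite -eN (sum_compositions_block_count _ E) //; last exact: tail_closed_strict.
set M := [set x | source E A x].
have M0 : M != set0.
  have /implyP/(_ A0)/existsP[x sx] := acE A.
  by apply/set0Pn; exists x; rewrite inE.
have sMA : M \subset A by apply/subsetP => x; rewrite inE => /andP[].
have := @sum_sign_subsets T R M M0.
rewrite (bigD1 set0) ?sub0set //= cards0 expr0 => /eqP.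
rewrite addr_eq0 => /eqP e; rewrite [RHS]e.
rewrite (bigID (fun B : {set T} => B \subset M)) /= [X in _ + X]big1 ?addr0; last first.
  by move=> B /andP[_ /negPf sB]; rewrite /strict_block sB mul0r.
rewrite -sumrN; apply: eq_big => [B|B]; first exact: andbC.
case/andP=> B0 sB; rewrite {1}/strict_block sB mul1r.
have sBA := subset_trans sB sMA.
have lt : (#|A :\: B| < N)%N.
  by rewrite cardsDS // -eN; move: B0 (subset_leq_card sBA); rewrite -card_gt0; lia.
transitivity ((-1) ^+ #|B|.+1 * \sum_(g <- compositions #|A :\: B|)
    sign_weight g * (block_count (strict_block E) g (A :\: B))%:R : R).
  rewrite mulr_sumr; apply: eq_bigr => g _.
  rewrite mulrA /sign_weight -exprD /=; congr (_ ^+ _ * _); lia.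
by rewrite (IH _ lt _ erefl) mulr1 exprS mulN1r.
Qed.

(** * Blocks generated by one element *)

Definition hull {T : finType} (E : rel T) (Q : {set T}) (p : T) : {set T} :=
  \bigcap_(D : {set T} | down E Q D && (p \in D)) D.

(* Elements generating the same hull are counted separately, so that no
   acyclicity assumption is needed. *)
Definition pointed_block {T : finType} (E : rel T) (Q A : {set T}) : nat :=
  #|[set p in Q | hull E Q p == A]|.

Lemma down_refl {T : finType} (E : rel T) (Q : {set T}) : down E Q Q.
Proof. by apply/downP; split. Qed.

Lemma hull_sub {T : finType} (E : rel T) (Q D : {set T}) p :
  down E Q D -> p \in D -> hull E Q p \subset D.
Proof. by move=> dD pD; apply: bigcap_inf; rewrite dD. Qed.

Lemma mem_hull {T : finType} (E : rel T) (Q : {set T}) p : p \in hull E Q p.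
Proof. by apply/bigcapP => D /andP[]. Qed.

Lemma down_hull {T : finType} (E : rel T) (Q : {set T}) p : p \in Q -> down E Q (hull E Q p).
Proof.
move=> pQ; apply/downP; split; first by rewrite hull_sub ?down_refl.
move=> x y xQ /bigcapP yh Exy; apply/bigcapP => D /andP[dD pD].
have /downP[_ h] := dD; apply: h Exy => //; apply: yh; by rewrite dD.
Qed.

Lemma hull_down {T : finType} (E : rel T) (Q A : {set T}) p :
  down E Q A -> p \in A -> hull E Q p = hull E A p.
Proof.
move=> dA pA; have /downP[sA _] := dA; apply/eqP; rewrite eqEsubset.
rewrite hull_sub ?mem_hull //=; last by apply: down_trans dA _; exact: down_hull.
rewrite hull_sub ?mem_hull //; apply: (down_sub _ Q) => //; first exact: hull_sub.
by apply: down_hull; apply: (subsetP sA).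
Qed.

Lemma tail_closed_pointed {T : finType} (E : rel T) : tail_closed E (pointed_block E).
Proof.
split=> [Q A|Q A B dA sB].
  rewrite cards_eq0 => /set0Pn[p]; rewrite inE => /andP[pQ /eqP <-].
  exact: down_hull.
have /downP[sA _] := dA.
apply: eq_card => p; rewrite !inE.
have [pA|pA] := boolP (p \in A).
  by rewrite (subsetP sA) //= (hull_down _ _ _ _ dA pA).
apply/andP => -[pQ /eqP hB]; case/negP: pA; apply: (subsetP sB).
by rewrite -hB mem_hull.
Qed.

Lemma pi_seq_rcons g k : pi_seq (rcons g k) = (pi_seq g * (sumn g + k))%N.
Proof.
rewrite /pi_seq size_rcons big_ord_recr /=; congr (_ * _)%N.
  by apply: eq_bigr => i _; rewrite -cats1 takel_cat.
by rewrite take_oversize ?size_rcons // -cats1 sumn_cat /= addn0.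
Qed.

(** The first block removed is the last part of [rev g], so by [pi_seq_rcons] it contributes the
    factor [1 / #|A|] whatever its size. The rest sums to [1] by induction. *)
Lemma sum_pointed_block_count {T : finType} (R : numFieldType) (E : rel T) (A : {set T}) :
  \sum_(g <- compositions #|A|)
     (pi_seq (rev g))%:R^-1 * (block_count (pointed_block E) g A)%:R = 1 :> R.
Proof.
move eN: #|A| => N; elim/ltn_ind: N A eN => N IH A eN.
have [A0|A0] := eqVneq A set0.
  by rewrite -eN A0 cards0 big_seq1 /= eqxx /pi_seq big_ord0 invr1 mulr1.
rewrite -eN (sum_compositions_block_count _ E) //; last exact: tail_closed_pointed.
have NA : #|A|%:R != 0 :> R by rewrite pnatr_eq0 cards_eq0.
transitivity (\sum_(B : {set T}) (pointed_block E A B)%:R * (#|A|%:R^-1 : R)).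
  rewrite [RHS](bigD1 set0) //=.
  have -> : pointed_block E A set0 = 0%N.
    apply: eq_card0 => p; rewrite inE; apply/andP => -[_ /eqP h].
    by have := mem_hull E A p; rewrite h inE.
  rewrite mul0r add0r; apply: eq_bigr => B B0.
  have [->|hB] := eqVneq (pointed_block E A B) 0%N; first by rewrite !mul0r.
  have /downP[sBA _] := (tail_closed_pointed E).1 _ _ hB.
  have lt : (#|A :\: B| < N)%N.
    by rewrite cardsDS // -eN; move: B0 (subset_leq_card sBA); rewrite -card_gt0; lia.
  congr (_ * _); transitivity (#|A|%:R^-1 * \sum_(g <- compositions #|A :\: B|)
    (pi_seq (rev g))%:R^-1 * (block_count (pointed_block E) g (A :\: B))%:R : R);
    last by rewrite (IH _ lt _ erefl) mulr1.
  rewrite mulr_sumr; apply: eq_big_seq => g; rewrite mem_compositions => /andP[_ /eqP sg].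
  rewrite rev_cons pi_seq_rcons sumn_rev sg cardsDS // subnK ?subset_leq_card //.
  by rewrite natrM invfM mulrA [X in X * _]mulrC.
rewrite -mulr_suml -natr_sum.
(* Each element of [A] generates exactly one block. *)
suff -> : (\sum_(B : {set T}) pointed_block E A B)%N = #|A| by rewrite mulfV.
under eq_bigr do rewrite /pointed_block -sum1_card.
rewrite (eq_bigr (fun B : {set T} => (\sum_(p in A | hull E A p == B) 1)%N)); last first.
  by move=> B _; apply: eq_bigl => p; rewrite inE.
by rewrite -(partition_big _ xpredT) // sum1_card.
Qed.

(** * Coefficient extraction *)

(* The extra top color has content 0 ([nth] past the end); it is used below to
   mark vertices that are not colored yet. *)
Definition part_content (b : seq nat) (i : 'I_(size b).+1) : nat := nth 0%N b i.

Fixpoint block_index (b : seq nat) (k : nat) : nat :=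
  if b is x :: b' then (if k < x then 0 else (block_index b' (k - x)).+1)%N else 0%N.

Lemma block_index_lt b k i : (k < sumn b)%N ->
  (block_index b k < i)%N = (k < sumn (take i b))%N.
Proof.
elim: b k i => [|x b IH] k [|i] //= kb.
case: (ltnP k x) => kx; first by rewrite ltn_addr.
by rewrite ltnS IH; lia.
Qed.

Lemma card_ord_lt n k : (k <= n)%N -> #|[set l : 'I_n | (l < k)%N]| = k.
Proof.
move=> kn; rewrite -sum1_card (eq_bigl (fun l : 'I_n => (l < k)%N)); last first.
  by move=> l; rewrite inE.
by rewrite (big_ord_narrow kn) sum1_card card_ord.
Qed.

(** An initial segment of ['I_n] is determined by its cardinality; this recovers a weakly increasing
    word from its content. *)
Lemma mem_initial_segment n (D : {set 'I_n}) (k : 'I_n) :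
  (forall l l' : 'I_n, (l <= l')%N -> l' \in D -> l \in D) -> (k \in D) = (k < #|D|)%N.
Proof.
move=> hD; have [kD|kD] := boolP (k \in D).
  apply/esym; rewrite -[X in (X <= _)%N](@card_ord_lt n k.+1) //; apply: subset_leq_card.
  by apply/subsetP => l; rewrite inE ltnS => lk; apply: hD kD.
apply/esym; rewrite ltnNge; apply: negbF; rewrite -[X in (_ <= X)%N](@card_ord_lt n k) ?(ltnW (ltn_ord k)) //.
apply: subset_leq_card; apply/subsetP => l lD; rewrite inE ltnNge.
by apply: contra kD => kl; apply: hD lD.
Qed.

Lemma sumn_take_nth (b : seq nat) i : sumn (take i b) = (\sum_(c < i) nth 0 b c)%N.
Proof.
elim: b i => [|x b IH] [|i] /=; rewrite ?big_ord0 //.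
  by rewrite big1 // => c _; rewrite nth_nil.
by rewrite big_ord_recl IH.
Qed.

Lemma card_below n N (f : 'I_n -> 'I_N) (e : 'I_N -> nat) i : has_content f e -> (i <= N)%N ->
  #|[set k | (f k < i)%N]| = (\sum_(c < N | c < i) e c)%N.
Proof.
move=> /forallP hf iN; rewrite -sum1_card.
rewrite (partition_big f (fun c => c < i)%N); last by move=> k; rewrite inE.
apply: eq_bigr => c ci; rewrite -(eqP (hf c)) -sum1_card; apply: eq_bigl => k.
by rewrite !inE; case: eqP => [->|]; rewrite ?andbF ?ci.
Qed.

(** Exactly one weakly increasing word has content [b], namely the word [j0] of block indices. It
    increases strictly at [s] precisely when [s] is a partial sum of [b]. *)
Lemma Fcoef_part_content n S b : b \in compositions n ->
  Fcoef n S (@part_content b) =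
  all (fun s => (s \in S) ==> (s \in psums b)) (iota 1 n.-1).
Proof.
rewrite mem_compositions => /andP[pb /eqP sb].
pose j0 : {ffun 'I_n -> 'I_(size b).+1} := [ffun k : 'I_n => inord (block_index b k)].
have kb (k : 'I_n) : (k < sumn b)%N by rewrite sb.
have j0E (k : 'I_n) : j0 k = block_index b k :> nat.
  by rewrite ffunE inordK // block_index_lt ?take_oversize.
have j0lt (k : 'I_n) i : (j0 k < i)%N = (k < sumn (take i b))%N by rewrite j0E block_index_lt.
have j0mono (k l : 'I_n) : (k <= l)%N -> (j0 k <= j0 l)%N.
  move=> kl; rewrite leqNgt j0lt -leqNgt (leq_trans _ kl) //.
  by rewrite leqNgt -j0lt ltnn.
have j0strict (k l : 'I_n) : l = k.+1 :> nat -> (j0 k < j0 l)%N = (val l \in psums b).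
  move=> lk; have hl : (sumn (take (j0 l) b) <= l)%N by rewrite leqNgt -j0lt ltnn.
  rewrite j0lt; apply/idP/psumsP => [h|[i ib e]].
    exists (j0 l); first by rewrite -ltnS; apply: ltn_ord.
    by apply/eqP; rewrite eqn_leq [val l]/= hl andbT lk.
  have : (i <= j0 l)%N by rewrite leqNgt j0lt -e ltnn.
  by rewrite -j0lt => /(leq_trans _); apply; rewrite j0lt -e /= lk.
have j0content : has_content j0 (@part_content b).
  apply/forallP => c; apply/eqP; rewrite /part_content.
  have below i : #|[set k | (j0 k < i)%N]| = sumn (take i b).
    rewrite -[RHS](@card_ord_lt n); last first.
      by rewrite -sb -[X in (_ <= sumn X)%N](cat_take_drop i) sumn_cat leq_addr.
    by apply: eq_card => k; rewrite !inE j0lt.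
  have -> : [set k | j0 k == c] = [set k | (j0 k < c.+1)%N] :\: [set k | (j0 k < c)%N].
    by apply/setP => k; rewrite !inE -val_eqE /=; lia.
  rewrite cardsDS; last by apply/subsetP => k; rewrite !inE => /ltnW.
  by rewrite !below !sumn_take_nth big_ord_recr /= addKn.
have uniq_j (j : {ffun 'I_n -> 'I_(size b).+1}) :
    (forall k l : 'I_n, l = k.+1 :> nat -> (j k <= j l)%N) ->
    has_content j (@part_content b) -> j = j0.
  move=> jm hc; have jmono (k l : 'I_n) : (k <= l)%N -> (j k <= j l)%N.
    case: l => l ln /=; elim: l ln => [|l IH] ln.
      by rewrite leqn0 => /eqP k0; have -> : k = Ordinal ln by exact: val_inj.
    rewrite leq_eqVlt => /orP[/eqP kl|kl].
      by have -> : k = Ordinal ln by exact: val_inj.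
    by apply: leq_trans (IH (ltnW ln) kl) _; apply: jm.
  (* Positions with color below [i] form an initial segment whose length is prescribed by the
     content. *)
  have jlt k i : (i <= (size b).+1)%N -> (j k < i)%N = (k < sumn (take i b))%N.
    move=> ib; have := @mem_initial_segment n [set k | (j k < i)%N] k; rewrite inE => ->.
      by rewrite (card_below _ _ _ _ _ hc ib) (big_ord_narrow ib) sumn_take_nth.
    by move=> l l' ll; rewrite !inE => /(leq_ltn_trans (jmono _ _ ll)).
  apply/ffunP => k; apply/val_inj/eqP; rewrite /= eqn_leq.
  rewrite -ltnS jlt ?(ltn_ord (j0 k)) // -j0lt leqnn /=.
  by rewrite -ltnS j0lt -jlt ?(ltn_ord (j k)) // leqnn.
rewrite /Fcoef; case: allP => hS.
  apply/eqP/cards1P; exists j0; apply/setP => j; rewrite !inE.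
  apply/andP/eqP => [[/forallP hj hc]|->].
    apply: uniq_j => // k l lk; move/forallP: (hj k) => /(_ l) /implyP.
    by rewrite /= lk => /(_ (eqxx _)) /andP[].
  split=> //; apply/forallP => k; apply/forallP => l; apply/implyP => /eqP lk.
  rewrite (j0strict _ _ lk) j0mono; last by rewrite [val l in X in (_ <= X)%N]lk.
  apply: (hS (val l)); rewrite mem_iota lk.
  by have := ltn_ord l; rewrite /= in lk *; lia.
apply/eqP; rewrite cards_eq0; apply/eqP/setP => j; rewrite !inE.
apply/negP => /andP[/forallP hj hc]; apply: hS => s.
rewrite mem_iota => hs; have sn : (s < n)%N by lia.
have s1n : (s.-1 < n)%N by lia.
have ej : j = j0.
  apply: uniq_j => // k l lk; move/forallP: (hj k) => /(_ l) /implyP.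
  by rewrite /= lk => /(_ (eqxx _)) /andP[].
move/forallP: (hj (Ordinal s1n)) => /(_ (Ordinal sn)) /implyP /=.
rewrite ej (j0strict (Ordinal s1n) (Ordinal sn)) /=; last lia.
by case/(_ _)/andP => //; apply/eqP; lia.
Qed.

Lemma Mcoef_part_content b a : pos b -> Mcoef a (@part_content b) = (a == b).
Proof.
move=> pb; rewrite /Mcoef eq_sym; congr (nat_of_bool (_ == _)).
(* The trailing [0] is the content of the extra color; the filter deletes it. *)
have -> : [seq part_content b i | i <- enum 'I_(size b).+1] = rcons b 0%N.
  rewrite (map_comp (nth 0%N b) val) val_enum_ord.
  by rewrite -addn1 iotaD map_cat map_nth_iota0 // take_size /= nth_default // cats1.
rewrite filter_rcons /=; apply/all_filterP; apply: sub_all pb => k; by rewrite lt0n.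
Qed.

Lemma mem_psums_cons s k a :
  (s \in psums (k :: a)) = (s == 0%N) || ((k <= s)%N && ((s - k)%N \in psums a)).
Proof.
rewrite -cat1s mem_psums_cat psums1 in_cons mem_seq1 /= addn0.
case: (s == 0%N) => //=; case: (eqVneq s k) => [->|//].
by rewrite leqnn subnn psums0.
Qed.

(** The two terms separate the compositions having [1] as a partial sum from the others. *)
Lemma big_compositionsSS {R : nmodType} n (F : seq nat -> R) :
  \sum_(a <- compositions n.+2) F a =
  \sum_(a <- compositions n.+1) (F (1%N :: a) + F ((head 0%N a).+1 :: behead a)).
Proof.
rewrite big_compositionsS big_ord_recl subn0 big_split; congr (_ + _).
rewrite [RHS]big_compositionsS; apply: eq_bigr => k _.
by rewrite /= /bump /= subSS.
Qed.

(** Inclusion-exclusion: compositions correspond to subsets of [{1, ..., n-1}], and the signed sum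
    over the sets containing [X] vanishes unless [X] is everything. *)
Lemma sum_sign_psums (R : comNzRingType) n (X : pred nat) :
  \sum_(a <- compositions n)
     sign_weight a * (all (fun s => X s ==> (s \in psums a)) (iota 1 n.-1))%:R
  = (all X (iota 1 n.-1))%:R :> R.
Proof.
case: n => [|n]; first by rewrite big_seq1 /sign_weight /= mulr1.
elim: n X => [|n IH] X.
  by rewrite big_seq1 /sign_weight /= mulr1 expr2 mulrNN mulr1.
rewrite big_compositionsSS [iota _ _]/= (iotaDl 1 1 n) /= all_map -mulnb natrM.
rewrite -(IH (X \o succn)) mulr_sumr; apply: eq_big_seq => a.
rewrite mem_compositions; case: a => [|k a] // /andP[/andP[k0 pa] _] /=.
rewrite !all_map !mem_psums_cons /= psums0 implybT /=.
rewrite ltnS leqn0 (gtn_eqF k0) /= implybF -mulnb natrM.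
have -> : all (preim (addn 1) (fun s => X s ==> (s \in psums [:: 1%N, k & a]))) (iota 1 n) =
          all (fun s => X s.+1 ==> (s \in psums (k :: a))) (iota 1 n).
  by apply: eq_all => s /=; rewrite mem_psums_cons /= add1n subn1.
have -> : all (preim (addn 1) (fun s => X s ==> (s \in psums (k.+1 :: a)))) (iota 1 n) =
          all (fun s => X s.+1 ==> (s \in psums (k :: a))) (iota 1 n).
  apply: eq_in_all => s; rewrite mem_iota => /andP[s0 _] /=.
  by rewrite !mem_psums_cons add1n subSS ltnS (gtn_eqF s0).
(* Prepending a part [1] keeps the sign, enlarging the first part flips it. The two terms cancel
   unless [X 1] holds, when only the first survives. *)
rewrite /sign_weight /= !(addnS, addSn, add0n) !exprS !mulN1r !opprK.
by case: (X 1%N); rewrite /= ?mul0r ?mulr0 ?mul1r ?addr0 // mulNr addNr.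
Qed.

(** * Strict colorings *)

(* The top color [size b] marks the vertices outside [Q]; the colors below [j]
   are unused. *)
Definition partial_coloring {T : finType} (E : rel T) (b : seq nat) (j : nat)
    (Q : {set T}) (f : {ffun T -> 'I_(size b).+1}) : bool :=
  [&& [forall x, (f x == size b :> nat) == (x \notin Q)],
      [forall x in Q, (j <= f x)%N],
      [forall c : 'I_(size b).+1, (j <= c < size b)%N ==>
         (#|[set x | f x == c]| == nth 0%N b c)] &
      [forall x in Q, forall y in Q, E x y ==> (f x < f y)%N]].

Lemma partial_coloringP {T : finType} (E : rel T) b j (Q : {set T})
    (f : {ffun T -> 'I_(size b).+1}) :
  reflect [/\ forall x, (f x == size b :> nat) = (x \notin Q),
              forall x, x \in Q -> (j <= f x)%N,
              forall c : 'I_(size b).+1, (j <= c < size b)%N ->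
                #|[set x | f x == c]| = nth 0%N b c &
              forall x y, x \in Q -> y \in Q -> E x y -> (f x < f y)%N]
          (partial_coloring E b j Q f).
Proof.
apply: (iffP and4P) => -[h1 h2 h3 h4]; split.
- by move=> x; move/forallP/(_ x)/eqP: h1.
- by move=> x xQ; move/forall_inP: h2; apply.
- by move=> c hc; apply/eqP; move/forallP/(_ c)/implyP: h3; apply.
- by move=> x y xQ yQ; move/forall_inP/(_ x xQ)/forall_inP/(_ y yQ)/implyP: h4.
- by apply/forallP => x; rewrite h1.
- by apply/forall_inP.
- by apply/forallP => c; apply/implyP => hc; rewrite h3.
- by apply/forall_inP => x xQ; apply/forall_inP => y yQ; apply/implyP; apply: h4.
Qed.

Lemma partial_coloring_first {T : finType} (E : rel T) b j (Q : {set T})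
    (f : {ffun T -> 'I_(size b).+1}) : (j < size b)%N -> partial_coloring E b j Q f ->
  (#|[set x | f x == j :> nat]| == nth 0%N b j) &&
  ([set x | f x == j :> nat] \subset [set x | source E Q x]).
Proof.
move=> jb /partial_coloringP[h1 h2 h3 h4].
have jb' : (j < (size b).+1)%N by exact: ltnW.
have := h3 (Ordinal jb') => /=; rewrite leqnn jb => <- //; rewrite eqxx /=.
apply/subsetP => x; rewrite !inE => /eqP fx.
have xQ : x \in Q by rewrite -[_ \in _]negbK -h1 fx ltn_eqF.
rewrite /source xQ; apply/forall_inP => y yQ; apply/negP => Eyx.
by have := h4 y x yQ xQ Eyx; rewrite fx ltnNge h2.
Qed.

(** Erasing color [j] from [A] and restoring it are inverse operations, matching colorings of [Q]
    with class [A] of color [j] to colorings of [Q :\: A] from [j.+1] on. *)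
Lemma partial_coloring_step {T : finType} (E : rel T) b j (Q A : {set T})
    (g : {ffun T -> 'I_(size b).+1}) : (j < size b)%N ->
  #|A| = nth 0%N b j -> A \subset [set x | source E Q x] ->
  let h (u v : 'I_(size b).+1) (f : {ffun T -> 'I_(size b).+1}) :=
    [ffun x => if x \in A then u else f x] in
  let f := h (inord j) ord_max g in
  [&& partial_coloring E b j Q f, [set x | f x == j :> nat] == A & h ord_max ord_max f == g]
  = partial_coloring E b j.+1 (Q :\: A) g.
Proof.
move=> jb cA sA h f.
have inj : (inord j : 'I_(size b).+1) = j :> nat by rewrite inordK // ltnW.
have AQ x : x \in A -> x \in Q by move/(subsetP sA); rewrite inE => /andP[].
have noE x y : x \in Q -> y \in A -> ~~ E x y.
  by move=> xQ /(subsetP sA); rewrite inE => /andP[_ /forall_inP]; apply.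
have fA x : x \in A -> f x = j :> nat by move=> xA; rewrite /f ffunE xA.
have fN x : x \notin A -> f x = g x by move=> xA; rewrite /f ffunE (negPf xA).
apply/and3P/partial_coloringP => [[/partial_coloringP[h1 h2 h3 h4] /eqP eA /eqP eg]|].
  have gA x : x \in A -> g x = ord_max by move=> xA; rewrite -eg ffunE xA.
  split=> [x|x /setDP[xQ xA]|c /andP[jc cb]|x y /setDP[xQ xA] /setDP[yQ yA] Exy].
  - rewrite inE; have [xA|xA] := boolP (x \in A); first by rewrite gA ?eqxx.
    by rewrite /= -h1 fN.
  - rewrite ltn_neqAle -fN // h2 // andbT.
    by apply: contraNneq xA => e; rewrite -eA inE -e.
  - rewrite -h3 ?(ltnW jc) //; apply: eq_card => x; rewrite !inE.
    have [xA|xA] := boolP (x \in A); last by rewrite fN.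
    by rewrite -!val_eqE /= gA // fA // gtn_eqF // ltn_eqF.
  - by rewrite -!fN // h4.
case=> h1 h2 h3 h4.
have gA x : x \in A -> g x = ord_max.
  by move=> xA; apply/val_inj/eqP; rewrite /= h1 inE xA.
have gj x : x \notin A -> (j < g x)%N.
  move=> xA; have [xQ|xQ] := boolP (x \in Q); first by rewrite h2 // inE xA.
  by have := h1 x; rewrite inE (negPf xQ) andbF => /eqP ->.
split.
- apply/partial_coloringP; split=> [x|x xQ|c /andP[jc cb]|x y xQ yQ Exy].
  + have [xA|xA] := boolP (x \in A); first by rewrite fA // (AQ x xA) ltn_eqF.
    by rewrite fN // h1 inE xA.
  + have [xA|xA] := boolP (x \in A); first by rewrite fA.
    by rewrite fN //; apply/ltnW/gj.
  + move: jc; rewrite leq_eqVlt => /orP[/eqP jc|jc].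
      rewrite -jc -cA; apply: eq_card => x; rewrite !inE -val_eqE /= -jc.
      have [xA|xA] := boolP (x \in A); first by rewrite fA ?eqxx.
      by rewrite fN // gtn_eqF ?gj.
    rewrite -h3 ?jc //; apply: eq_card => x; rewrite !inE.
    have [xA|xA] := boolP (x \in A); last by rewrite fN.
    by rewrite -!val_eqE /= gA // fA // ltn_eqF // gtn_eqF.
  + have yA : y \notin A by apply: contraL Exy; apply: noE.
    rewrite (fN y) //; have [xA|xA] := boolP (x \in A); first by rewrite fA // gj.
    by rewrite fN // h4 // inE ?xA ?yA.
- apply/eqP/setP => x; rewrite inE.
  have [xA|xA] := boolP (x \in A); first by rewrite fA ?eqxx.
  by rewrite fN // gtn_eqF ?gj.
- apply/eqP/ffunP => x; rewrite ffunE; have [xA|xA] := boolP (x \in A).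
    by rewrite gA.
  by rewrite fN.
Qed.

(** Fibering over the class of color [j] turns successive color classes into successive blocks of
    sources. *)
Lemma card_partial_coloring {T : finType} (E : rel T) b j (Q : {set T}) : (j <= size b)%N ->
  #|[set f : {ffun T -> 'I_(size b).+1} | partial_coloring E b j Q f]|
  = block_count (strict_block E) (drop j b) Q.
Proof.
move: {2}(size b - j)%N (erefl (size b - j)%N) => k; elim: k j Q => [|k IH] j Q hk jb.
  have {hk jb} -> : j = size b by lia.
  rewrite drop_size /=; have [->|Q0] := eqVneq Q set0.
    apply/eqP/cards1P; exists [ffun=> ord_max]; apply/setP => f; rewrite !inE.
    apply/partial_coloringP/eqP => [[h1 _ _ _]|->].
      by apply/ffunP => x; apply/val_inj/eqP; rewrite ffunE h1 inE.
    by split=> [x|x|c|x y]; rewrite ?ffunE ?inE ?eqxx //; lia.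
  apply/eqP; rewrite cards_eq0; apply/eqP/setP => f; rewrite !inE.
  apply/partial_coloringP => -[h1 h2 _ _]; case/set0Pn: Q0 => x xQ.
  have := h1 x; rewrite xQ => /negP; apply.
  by rewrite eqn_leq h2 // -ltnS ltn_ord.
have {jb} jb : (j < size b)%N by lia.
rewrite (drop_nth 0%N jb) /= -sum1_card.
rewrite (partition_big (fun f : {ffun T -> 'I_(size b).+1} => [set x | f x == j :> nat])
  (fun A => (#|A| == nth 0%N b j) && (A \subset [set x | source E Q x]))) /=; last first.
  by move=> f; rewrite inE => /(partial_coloring_first _ _ _ _ _ jb).
rewrite [RHS](bigID (fun A : {set T} => A \subset [set x | source E Q x])) /=.
rewrite [X in _ = (_ + X)%N]big1 ?addn0; last first.
  by move=> A /andP[_ /negPf sA]; rewrite /strict_block sA.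
apply: eq_bigr => A /andP[/eqP cA sA]; rewrite /strict_block sA mul1n.
rewrite -/(strict_block E) -IH; [|lia|lia].
rewrite -sum1_card (reindex_onto
  (fun g : {ffun T -> 'I_(size b).+1} => [ffun x => if x \in A then inord j else g x])
  (fun f : {ffun T -> 'I_(size b).+1} => [ffun x => if x \in A then ord_max else f x])) /=.
  apply: eq_bigl => g; rewrite !inE -(partial_coloring_step _ _ _ _ _ _ jb cA sA) /=.
  by rewrite -andbA.
move=> f /andP[_ /eqP eA]; apply/ffunP => x; rewrite !ffunE.
have [xA|//] := boolP (x \in A); apply/val_inj; rewrite /= inordK; last exact: ltnW.
by move: xA; rewrite -eA inE => /eqP.
Qed.

Lemma card_strict_coloring n (E : rel 'I_n) b :
  #|[set f : {ffun 'I_n -> 'I_(size b).+1} | has_content f (@part_content b) &&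
      [forall x, forall y, E x y ==> (f x < f y)%N]]|
  = block_count (strict_block E) b setT.
Proof.
rewrite -[b in block_count _ b]drop0 -card_partial_coloring //.
apply: eq_card => f; rewrite !inE.
apply/andP/partial_coloringP => [[/forallP hc /forallP hE]|[h1 _ h3 h4]].
  split=> [x|//|c _|x y _ _].
  - rewrite inE /=; apply/negP => /eqP fx.
    (* The top color has content [0], so no vertex carries it. *)
    have := hc ord_max; rewrite /part_content /= nth_default // cards_eq0 => /eqP/setP/(_ x).
    by rewrite !inE => /negP; apply; apply/eqP/val_inj.
  - exact/eqP.
  - by move/forallP/(_ y)/implyP: (hE x).
split; last by apply/forallP => x; apply/forallP => y; apply/implyP; apply: h4.
apply/forallP => c; rewrite /part_content; have [cb|cb] := ltnP c (size b).
  by rewrite h3.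
rewrite nth_default // cards_eq0; apply/eqP/setP => x; rewrite !inE.
apply/negP => /eqP fx; have := h1 x; rewrite inE /= => /negP; apply.
by rewrite fx eqn_leq cb andbT -ltnS ltn_ord.
Qed.

(** * Expansion over edge sets *)

Definition edge_weight n (m : 'I_n -> 'I_n -> nat) (E : {set 'I_n * 'I_n}) : {poly rat} :=
  \prod_(p in E) (('X + 1) ^+ m p.1 p.2 - 1).

Definition edge_rel {T : finType} (E : {set T * T}) : rel T := fun x y => (x, y) \in E.

Lemma shift_asc n N (m : 'I_n -> 'I_n -> nat) (f : 'I_n -> 'I_N) :
  ('X + 1) ^+ asc m f =
  \sum_(E : {set 'I_n * 'I_n})
     edge_weight _ m E * [forall x, forall y, edge_rel E x y ==> (f x < f y)%N]%:R.
Proof.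
rewrite /asc pair_bigA /= expr_sum.
rewrite (eq_bigr (fun p : 'I_n * 'I_n =>
  (if (f p.1 < f p.2)%N then ('X + 1) ^+ m p.1 p.2 - 1 else 0) + 1)); last first.
  by move=> p _; case: ifP => _; rewrite ?subrK // expr0 add0r.
rewrite (@bigA_distr _ 0 1 *%R +%R _ _ (fun=> 1)); apply: eq_bigr => E _.
rewrite -big_mkcond /=; case: (boolP [forall x, _]) => [/forallP hE|hE].
  rewrite mulr1; apply: eq_bigr => -[x y] xyE /=.
  by move/forallP/(_ y)/implyP: (hE x) => ->.
rewrite mulr0; move: hE; rewrite negb_forall => /existsP[x].
rewrite negb_forall => /existsP[y]; rewrite negb_imply => /andP[xyE /negPf lt].
by rewrite (bigD1 (x, y)) //= lt mul0r.
Qed.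

Lemma Gcoef_shift_part_content n (m : 'I_n -> 'I_n -> nat) b :
  Gcoef_shift m (@part_content b) =
  \sum_(E : {set 'I_n * 'I_n})
     edge_weight _ m E * (block_count (strict_block (edge_rel E)) b setT)%:R.
Proof.
rewrite /Gcoef_shift; under eq_bigr do rewrite shift_asc.
rewrite exchange_big /=; apply: eq_bigr => E _.
rewrite -mulr_sumr -card_strict_coloring -sum1_card natr_sum; congr (_ * _).
rewrite big_mkcond [RHS]big_mkcond; apply: eq_bigr => f _; rewrite inE.
by case: (has_content _ _); case: [forall x, _].
Qed.

(** In a nonempty set without a source, a vertex of least color has a predecessor in the set, whose
    color cannot be smaller. *)
Lemma strict_block_count_cyclic {T : finType} (E : rel T) b :
  ~~ acyclic E -> block_count (strict_block E) b setT = 0%N.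
Proof.
rewrite negb_forall => /existsP[A]; rewrite negb_imply negb_exists.
case/andP=> A0 /forallP hA.
rewrite -[b]drop0 -card_partial_coloring //; apply/eqP; rewrite cards_eq0.
apply/eqP/setP => f; rewrite !inE; apply/partial_coloringP => -[_ _ _ h4].
case/set0Pn: A0 => x0 x0A; case: (arg_minnP (fun x => f x : nat) x0A) => x xA xmin.
have {}xA : x \in A by [].
have := hA x; rewrite /source xA negb_forall => /existsP[y].
rewrite negb_imply negbK => /andP[yA Eyx].
by have := h4 y x (in_setT y) (in_setT x) Eyx; rewrite ltnNge xmin.
Qed.

(** * Change of basis *)

(** Blocks are located by partial sums from the left, so appending a group on the right leaves the
    earlier ones unchanged. *)
Lemma pi2_cat_rcons a g b k : pos a -> pos g -> (0 < k)%N -> sumn a = sumn b -> sumn g = k ->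
  pi2 (a ++ g) (rcons b k) = (pi2 a b * pi_seq g)%N.
Proof.
move=> pa pg k0 sab sg; rewrite /pi2 size_rcons big_ord_recr /=.
have pag : pos (a ++ g) by rewrite all_cat pa.
have tb i : (i <= size b)%N -> take i (rcons b k) = take i b.
  by move=> ib; rewrite -cats1 takel_cat.
have ta j : (j <= size a)%N -> take j (a ++ g) = take j a by move=> ja; rewrite takel_cat.
congr (_ * _)%N.
  apply: eq_bigr => i _; congr pi_seq; rewrite /sub_parts size_cat iotaD add0n.
  (* Parts of [g] end beyond [sumn a = sumn b], hence outside every earlier block. *)
  rewrite filter_cat [filter _ (iota (size a) _)](_ : _ = [::]) ?cats0; last first.
    rewrite -(filter_pred0 (iota (size a) (size g))); apply: eq_in_filter => j.
    rewrite mem_iota => hj; apply/negP => /andP[_]; apply/negP; rewrite -ltnNge.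
    rewrite tb; last exact: ltn_ord.
    apply: leq_ltn_trans (_ : sumn a < _)%N.
      by rewrite sab -[X in (_ <= sumn X)%N](cat_take_drop i.+1) sumn_cat leq_addr.
    rewrite -[X in (sumn X < _)%N](@take_size_cat _ (size a) a g) //.
    by rewrite sumn_take_lt // size_cat; lia.
  rewrite (eq_in_filter (a2 := fun j => (sumn (take i b) <= sumn (take j a))%N &&
     (sumn (take j.+1 a) <= sumn (take i.+1 b))%N)); last first.
    move=> j; rewrite mem_iota => hj; rewrite !tb ?(ltnW (ltn_ord i)) //.
    by rewrite !ta //; lia.
  apply/eq_in_map => j; rewrite mem_filter mem_iota => /andP[_ hj].
  by rewrite nth_cat; have -> : (j < size a)%N by lia.
congr pi_seq; rewrite /sub_parts size_cat iotaD add0n filter_cat.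
rewrite tb // take_size (@take_oversize _ _ (rcons b k)) ?size_rcons //.
have sbk : sumn (rcons b k) = sumn (a ++ g).
  by rewrite -cats1 !sumn_cat /= addn0 sab sg.
(* Parts of [a] begin before the last block does. *)
rewrite [filter _ (iota 0 _)](_ : _ = [::]) ?cat0s; last first.
  rewrite -(filter_pred0 (iota 0 (size a))); apply: eq_in_filter => j.
  rewrite mem_iota => hj; apply/negP => /andP[+ _]; apply/negP; rewrite -ltnNge.
  rewrite ta; last lia.
  by rewrite -sab -{2}(take_size a) sumn_take_lt //; lia.
rewrite (_ : [seq j <- _ | _] = iota (size a) (size g)).
  by rewrite map_nth_iota ?size_cat ?addKn // drop_size_cat // take_size.
apply/all_filterP/allP => j.
rewrite mem_iota => hj; rewrite sbk -[X in _ && (_ <= sumn X)%N](cat_take_drop j.+1).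
rewrite sumn_cat leq_addr andbT -sab take_cat ltnNge.
by have -> /= : (size a <= j)%N by [lia]; rewrite sumn_cat leq_addr.
Qed.

Lemma pi_seq1 k : pi_seq [:: k] = k.
Proof. by rewrite /pi_seq big_ord1 /= addn0. Qed.

Lemma pi2_diag_gt0 b : pos b -> (0 < pi2 b b)%N.
Proof.
elim/last_ind: b => [|b k IH]; first by rewrite /pi2 big_ord0.
rewrite all_rcons => /andP[k0 pb].
by rewrite -{1}cats1 pi2_cat_rcons //= ?k0 ?addn0 // pi_seq1 muln_gt0 IH.
Qed.

Lemma zee_gt0 a : (0 < zee a)%N.
Proof.
rewrite /zee big_seq; elim/big_ind: _ => // [x y x0 y0|i]; first by rewrite muln_gt0 x0.
by rewrite mem_index_iota => /andP[i0 _]; rewrite muln_gt0 fact_gt0 expn_gt0 i0.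
Qed.

(** Types are reversed because the last factor of [pi_seq] is the full sum: the part read last must
    be the block removed first. *)
Lemma weak_block_count_pointed (R : numFieldType) {T : finType} (E : rel T) b (Q : {set T}) :
  pos b ->
  (block_count (weak_block E) (rev b) Q)%:R =
  \sum_(a <- refinements b)
     (pi2 a b)%:R^-1 * (block_count (pointed_block E) (rev a) Q)%:R :> R.
Proof.
move=> pb; rewrite big_refinements_rev //.
under eq_bigr do rewrite revK.
rewrite -(sum_refinements_block_count R E (pointed_block E) (fun g => (pi_seq (rev g))%:R^-1)
  (fun b a => (pi2 (rev a) (rev b))%:R^-1)) ?revK //.
- exact: tail_closed_pointed.
- exact: sum_pointed_block_count.
- by rewrite /pi2 big_ord0 invr1.
- move=> k c g a k0 pc; rewrite mem_compositions mem_refinements //.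
  move=> /andP[pg /eqP sg] /and3P[pa /eqP sa _].
  rewrite rev_cat rev_cons pi2_cat_rcons ?all_rev ?sumn_rev //.
  by rewrite natrM invfM mulrC.
- by rewrite all_rev.
Qed.

Lemma weak_block_count_strict (R : comNzRingType) {T : finType} (E : rel T) b (Q : {set T}) :
  acyclic E -> pos b ->
  (block_count (weak_block E) b Q)%:R =
  \sum_(a <- refinements b) sign_weight a * (block_count (strict_block E) a Q)%:R :> R.
Proof.
move=> acE pb; rewrite -(sum_refinements_block_count R E (strict_block E) sign_weight
  (fun _ => sign_weight)) //.
- exact: tail_closed_strict.
- by move=> A; apply: sum_strict_block_count.
- move=> k c g a _ _ _ _; rewrite /sign_weight -exprD sumn_cat size_cat.
  by congr (_ ^+ _); lia.
Qed.

(** * Effect of [omega] on monomial coefficients *)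

Lemma comp_le_all n a b : a \in compositions n -> b \in compositions n ->
  comp_le b a = all (fun s => (s \in psums a) ==> (s \in psums b)) (iota 1 n.-1).
Proof.
rewrite !mem_compositions => /andP[pa /eqP sa] /andP[pb /eqP sb].
apply/allP/allP => h s.
  rewrite mem_iota => hs; apply/implyP => sP.
  have := h s; rewrite !mem_desc // sa sb sP => /(_ _)/andP[] //; lia.
rewrite !mem_desc // sa sb => /andP[sP s0]; rewrite s0 andbT.
by apply: implyP sP; apply: h; rewrite mem_iota; lia.
Qed.

Lemma Fcoef_desc n a b : a \in compositions n -> b \in compositions n ->
  Fcoef n (desc a) (@part_content b) = comp_le b a.
Proof.
move=> ha hb; rewrite Fcoef_part_content // (comp_le_all n) //; congr nat_of_bool.
apply: eq_in_all => s; move: ha; rewrite mem_iota mem_compositions => /andP[pa /eqP sa] hs.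
by rewrite mem_desc // sa; have -> : (0 < s < n)%N by [lia]; rewrite andbT.
Qed.

(** The substitution of [n - s] for [s] moves the reflection in [omega_set] from [a] to [b]; the
    complement turns the implication into a disjunction. *)
Lemma Fcoef_omega_set n a b : a \in compositions n -> b \in compositions n ->
  Fcoef n (omega_set n (desc a)) (@part_content b) =
  all (fun s => (s \in psums a) || (s \in psums (rev b))) (iota 1 n.-1).
Proof.
move=> ha hb; rewrite Fcoef_part_content //; congr nat_of_bool.
move: ha hb; rewrite !mem_compositions => /andP[pa /eqP sa] /andP[pb /eqP sb].
have E s : (0 < s < n)%N -> ((s \in omega_set n (desc a)) ==> (s \in psums b)) =
    ((n - s)%N \in psums a) || ((n - s)%N \in psums (rev b)).
  move=> hs; rewrite mem_filter mem_iota mem_desc // sa mem_psums_rev ?sb ?leq_subr //.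
  rewrite subKn; last lia.
  have -> : (0 < n - s < n)%N by lia.
  have -> : (1 <= s < 1 + n.-1)%N by lia.
  by rewrite !andbT implyNb.
apply/allP/allP => h s; rewrite mem_iota => hs; have sn : (0 < s < n)%N by lia.
  have := h (n - s)%N; rewrite mem_iota E; last lia.
  by rewrite subKn => [->|]; lia.
by rewrite E //; apply: h; rewrite mem_iota; lia.
Qed.

(** By [sum_sign_psums], the condition that [a] and [rev b] together cover all positions is a signed
    sum over the [v] refining both. Refining [a] means that [M_v] occurs in the fundamental function
    of [a]. *)
Lemma omega_signed_sum n (d : seq nat -> {poly rat}) b : b \in compositions n ->
  \sum_(a <- compositions n) d a * (Fcoef n (omega_set n (desc a)) (@part_content b))%:R =
  \sum_(v <- refinements (rev b)) sign_weight v *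
     \sum_(a <- compositions n) d a * (Fcoef n (desc a) (@part_content v))%:R.
Proof.
move=> hb; have hrb : rev b \in compositions n by rewrite compositions_rev.
rewrite -(big_comp_le n) // [RHS]big_mkcond /=.
transitivity (\sum_(v <- compositions n) \sum_(a <- compositions n)
   d a * (sign_weight v * (all (fun s => ((s \in psums a) || (s \in psums (rev b))) ==>
     (s \in psums v)) (iota 1 n.-1))%:R)).
  rewrite exchange_big /=; apply: eq_big_seq => a ha.
  by rewrite -mulr_sumr sum_sign_psums Fcoef_omega_set.
apply: eq_big_seq => v hv; rewrite (comp_le_all n) //.
transitivity ((all (fun s => (s \in psums (rev b)) ==> (s \in psums v)) (iota 1 n.-1))%:R *
    (sign_weight v * \sum_(a <- compositions n) d a * (Fcoef n (desc a) (@part_content v))%:R)).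
  rewrite !mulr_sumr; apply: eq_big_seq => a ha; rewrite Fcoef_desc // (comp_le_all n) //.
  rewrite (mulrCA (d a)) (mulrCA _ (sign_weight v)); congr (_ * _).
  rewrite (mulrCA _ (d a)); congr (_ * _); rewrite -natrM mulnb; congr (_ %:R).
  rewrite -all_predI; congr nat_of_bool; apply: eq_all => s /=.
  by do 3 case: (_ \in _).
by case: (all _ _); rewrite ?mul1r ?mul0r.
Qed.

(** * Uniqueness of the expansion and positivity *)

(** The system is triangular with nonzero diagonal: the equation at [b] involves, besides [c b],
    only strictly longer compositions. *)
Lemma expansion_unique (R : numDomainType) n (c c' : seq nat -> {poly R})
    (p : seq nat -> seq nat -> R) :
  (forall b, b \in compositions n -> p b b != 0) ->
  (forall b, b \in compositions n ->
     \sum_(a <- refinements b) c a * (p a b)%:P = \sum_(a <- refinements b) c' a * (p a b)%:P) ->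
  forall b, b \in compositions n -> c b = c' b.
Proof.
move=> pn0 h b; move eK: (n - size b)%N => K; elim/ltn_ind: K b eK => K IH b eK hb.
have := hb; rewrite mem_compositions => /andP[pb /eqP sb].
have bb : b \in refinements b.
  by rewrite mem_refinements // pb eqxx /=; apply/(comp_leP _ _ pb pb erefl).
have := h b hb; rewrite !(big_rem b bb) /=.
rewrite [X in _ + X = _](eq_big_seq (fun a => c' a * (p a b)%:P)).
  by move/addIr/(mulIf _); apply; rewrite polyC_eq0 pn0.
move=> a; rewrite mem_rem_uniq ?uniq_refinements // inE => /andP[ab ha].
have := refinements_size _ _ pb ha; rewrite (negPf ab) orbF => sab.
move: ha; rewrite mem_refinements // => /and3P[pa /eqP sa _].
have san := pos_size _ pa; congr (_ * _); apply: (IH (n - size a)%N) => //.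
  by rewrite -eK; rewrite sa sb in san; apply: ltn_sub2l; first exact: leq_trans san.
by rewrite mem_compositions pa sa sb eqxx.
Qed.

(** Packaged as a closed semiring so that [polyOver] inherits closure under sums and products. *)
Definition nat_rat : semiringClosed rat := (@Num.nat_num_subdef rat : {pred rat}).

Lemma edge_weight_nat n (m : 'I_n -> 'I_n -> nat) E : edge_weight _ m E \is a polyOver nat_rat.
Proof.
apply: rpred_prod => p _; elim: (m _ _) => [|k IH]; first by rewrite expr0 subrr rpred0.
have -> : ('X + 1) ^+ k.+1 - 1 = (('X + 1) ^+ k - 1) * ('X + 1) + 'X :> {poly rat}.
  by rewrite exprSr mulrBl mul1r opprD addrA addrAC subrK.
by rewrite rpredD ?polyOverX // rpredM // rpredD ?polyOverX ?rpred1.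
Qed.

Theorem theorem7p7 (n : nat) (m : 'I_n -> 'I_n -> nat)
  (noloop : forall i, m i i = 0%N)
  (d c : seq nat -> {poly rat}) :
  (* G_G(x;q+1) = sum_alpha d_alpha F_{n,S_alpha} *)
  (forall (N : nat) (e : 'I_N -> nat),
     Gcoef_shift m e = \sum_(a <- compositions n) d a * (Fcoef n (desc a) e)%:R) ->
  (* omega G_G(x;q+1) = sum_alpha c_alpha Psi_alpha / z_alpha *)
  (forall (N : nat) (e : 'I_N -> nat),
     \sum_(a <- compositions n) d a * (Fcoef n (omega_set n (desc a)) e)%:R
     = \sum_(a <- compositions n) c a * (Psi_coef n a e / (zee a)%:R)%:P) ->
  forall a, a \in compositions n ->
  forall i : nat, exists k : nat, (c a)`_i = k%:R.
Proof.
move=> hd hc.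
(* The explicit answer, with natural coefficients by construction: pointed chains of type [rev a],
   summed over acyclic edge sets with their weights. *)
pose c' a : {poly rat} := \sum_(E : {set 'I_n * 'I_n} | acyclic (edge_rel E))
  edge_weight _ m E * (block_count (pointed_block (edge_rel E)) (rev a) setT)%:R.
suff cE : forall a, a \in compositions n -> c a = c' a.
  move=> a /cE -> i; apply/natrP; move: i; apply/polyOverP.
  by apply: rpred_sum => E _; rewrite rpredM ?edge_weight_nat ?rpred_nat.
apply: (expansion_unique _ _ _ _ (fun a b => (pi2 a b)%:R^-1)) => b hb.
  move: hb; rewrite mem_compositions => /andP[pb _].
  by rewrite invr_eq0 pnatr_eq0 -lt0n pi2_diag_gt0.
have := hb; rewrite mem_compositions => /andP[pb _].
(* Evaluation at content [b] extracts the coefficient of [M_b]; [zee a] cancels and [1 / pi2 a b] is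
   left. *)
transitivity (\sum_(a <- compositions n) c a * (Psi_coef n a (@part_content b) / (zee a)%:R)%:P).
  rewrite -(big_comp_le n) // big_mkcond /=; apply: eq_bigr => a _.
  have z0 : (zee a)%:R != 0 :> rat by rewrite pnatr_eq0 -lt0n zee_gt0.
  rewrite /Psi_coef mulrAC mulfV // mul1r big_mkcond /=.
  rewrite (bigD1_seq b) ?uniq_compositions //= big1 ?addr0; last first.
    by move=> b' /negPf bb'; rewrite Mcoef_part_content // bb' mulr0 if_same.
  rewrite Mcoef_part_content // eqxx mulr1.
  by case: comp_le; rewrite ?mulr0.
rewrite -hc omega_signed_sum //.
under eq_bigr do rewrite -hd Gcoef_shift_part_content mulr_sumr.
rewrite exchange_big /= (bigID (fun E => acyclic (edge_rel E))) /= [X in _ + X]big1 ?addr0; last first.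
  by move=> E /strict_block_count_cyclic z; rewrite big1 // => v _; rewrite z !mulr0.
under [RHS]eq_bigr do rewrite mulr_suml.
rewrite [RHS]exchange_big /=; apply: eq_bigr => E acE.
under eq_bigr do rewrite mulrCA.
(* Both sides meet in the weak count of type [rev b]: the signs coming from [omega] produce it, and
   the pointed counts resolve it. *)
rewrite -mulr_sumr -weak_block_count_strict ?all_rev //.
rewrite -[LHS]/(_ * _) -(polyC_natr) (weak_block_count_pointed rat) // rmorph_sum mulr_sumr.
apply: eq_bigr => a _; rewrite -mulrA; congr (_ * _).
by rewrite rmorphM /= mulrC -polyC_natr.
Qed.
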